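(* Let $\kappa>0$ and $r_i,r_{i+1}\in\mathbb{R}^3$ be fixed, and let $r_s\in\mathbb{R}^3$ be reachable, by a two-impulse trajectory from $r_i$ to $r_{i+1}$, at some $t\in(0,\pi/\kappa)$. Let $\mathcal{S}\subset\mathbb{R}^3$ be a set whose boundary $\partial\mathcal{S}$ is a connected closed surface, and suppose $r_s\notin\mathcal{S}$. If every point of $\partial\mathcal{S}$ is unreachable (by a two-impulse trajectory from $r_i$ to $r_{i+1}$) at every $t\in(0,\pi/\kappa)$, then every point of $\mathcal{S}$ is unreachable at every $t\in(0,\pi/\kappa)$; that is, $$\partial\mathcal{S}\cap\mathcal{Q}_{i,i+1}=\varnothing\ \Longrightarrow\ \mathcal{S}\cap\mathcal{Q}_{i,i+1}=\varnothing .$$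
   Context: Setting: a chaser spacecraft moves relative to a target at the origin on a circular orbit with mean motion $\kappa>0$, governed by the Clohessy–Wiltshire equations. With position $r_i$ and post-impulse velocity $v_i^+$, the position after elapsed time $t$ is $F_{rr}(t)r_i+F_{rv}(t)v_i^+$, where, with $\theta=\kappa t$, $$F_{rr}(t)=\begin{pmatrix}4-3\cos\theta&0&0\\6(\sin\theta-\theta)&1&0\\0&0&\cos\theta\end{pmatrix},\quad F_{rv}(t)=\frac1\kappa\begin{pmatrix}\sin\theta&2(1-\cos\theta)&0\\-2(1-\cos\theta)&4\sin\theta-3\theta&0\\0&0&\sin\theta\end{pmatrix}.$$ $F_{rv}(\tau)$ is invertible for $\tau\in(0,\pi/\kappa)$; transfer times always lie in $(0,\pi/\kappa)$. Define $$F_2(t,\tau)=F_{rv}(t)F_{rv}(\tau)^{-1},\qquad F_1(t,\tau)=F_{rr}(t)-F_2(t,\tau)F_{rr}(\tau).$$ Time $t$ is measured from the first impulse. For $t\in(0,\pi/\kappa)$ let $$\mathcal{R}_{i,i+1}(t)=\{F_1(t,\tau)r_i+F_2(t,\tau)r_{i+1}\,:\,\tau\in(t,\pi/\kappa)\},\qquad \mathcal{Q}_{i,i+1}=\bigcup_{t\in(0,\pi/\kappa)}\mathcal{R}_{i,i+1}(t).$$ A point is reachable at time $t$ (by a two-impulse trajectory from $r_i$ to $r_{i+1}$) iff it lies in $\mathcal{R}_{i,i+1}(t)$, i.e. some trajectory starting at $r_i$ and ending at $r_{i+1}$ with some transfer time $\tau\in(t,\pi/\kappa)$ passes through it at time $t$;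 otherwise it is unreachable at $t$. ''Connected closed surface'' means a connected surface that is closed as a subset of $\mathbb{R}^3$. *)

(* Defs.v *)
From HB Require Import structures.
From mathcomp Require Import all_boot all_order all_algebra.
From mathcomp Require Import all_classical all_reals all_analysis.

Set Implicit Arguments.
Unset Strict Implicit.
Unset Printing Implicit Defensive.

Import Order.TTheory GRing.Theory Num.Theory.
Import numFieldNormedType.Exports.

Local Open Scope classical_set_scope.
Local Open Scope ring_scope.

Definition boundary (T : topologicalType) (A : set T) : set T :=
  closure A `\` interior A.

Definition homeomorphic_sets (T U : ptopologicalType) (A : set T) (B : set U) :
    Prop :=
  exists (f : T -> U) (g : U -> T),
    [/\ set_fun A B f, set_fun B A g,
        {in A, cancel f g} /\ {in B, cancel g f},
        {within A, continuous f} & {within B, continuous g}].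

(* A topological 2-manifold without boundary, embedded in R^3: no smoothness
   or compactness is required.  The Hausdorff and second countability axioms
   are inherited from R^3. *)
Definition is_surface (R : realType) (M : set 'cV[R]_3) : Prop :=
  forall p, M p ->
    exists (U : set 'cV[R]_3) (V : set 'cV[R]_2),
      [/\ open U, U p, open V & homeomorphic_sets (M `&` U) V].

Definition connected_closed_surface (R : realType) (M : set 'cV[R]_3) : Prop :=
  [/\ is_surface M, connected M & closed M].

Definition mx3_of_rows (R : realType) (rows : seq (seq R)) : 'M[R]_3 :=
  \matrix_(i < 3, j < 3) nth 0 (nth [::] rows i) j.

Section ClohessyWiltshire.
Variables (R : realType) (kappa : R).

(* In coordinates centred at the target, the chaser's position at elapsed time
   t is Frr t *m r + Frv t *m v, where r is the initial position and v the
   velocity just after the first impulse. *)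
Definition Frr (t : R) : 'M[R]_3 :=
  let theta := kappa * t in
  mx3_of_rows
    [:: [:: 4 - 3 * cos theta;         0; 0];
        [:: 6 * (sin theta - theta);   1; 0];
        [:: 0;                         0; cos theta]].

Definition Frv (t : R) : 'M[R]_3 :=
  let theta := kappa * t in
  kappa^-1 *: mx3_of_rows
    [:: [:: sin theta;                 2 * (1 - cos theta);         0];
        [:: - (2 * (1 - cos theta));   4 * sin theta - 3 * theta;   0];
        [:: 0;                         0;                           sin theta]].

(* invmx A is A itself when A is singular; this case does not arise below,
   since Frv tau is invertible for kappa > 0 and 0 < tau < pi / kappa. *)
Definition F2 (t tau : R) : 'M[R]_3 := Frv t *m invmx (Frv tau).

Definition F1 (t tau : R) : 'M[R]_3 := Frr t - F2 t tau *m Frr tau.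

Definition reach_set (ri rj : 'cV[R]_3) (t : R) : set 'cV[R]_3 :=
  [set F1 t tau *m ri + F2 t tau *m rj | tau in `]t, (pi / kappa)[].

Definition reach_union (ri rj : 'cV[R]_3) : set 'cV[R]_3 :=
  \bigcup_(t in `]0, (pi / kappa)[) reach_set ri rj t.

Definition reachable_at (ri rj : 'cV[R]_3) (t : R) (p : 'cV[R]_3) : Prop :=
  reach_set ri rj t p.

Definition unreachable_at (ri rj : 'cV[R]_3) (t : R) (p : 'cV[R]_3) : Prop :=
  ~ reachable_at ri rj t p.

End ClohessyWiltshire.

(* Main.v *)
(** The reachable union [Q] is the image of the convex triangle
    [0 < t < tau < pi / kappa] under
    [(t, tau) |-> F1 t tau *m ri + F2 t tau *m rj].  This map is continuous
    because [\det (Frv tau)] does not vanish on [(0, pi / kappa)], so [Q] is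
    connected; and a connected set that meets [S] but not its boundary lies
    inside [S], which [rs] forbids. *)
Require Import Defs.
From HB Require Import structures.
From mathcomp Require Import all_boot all_order all_algebra.
From mathcomp Require Import all_classical all_reals all_analysis.
From mathcomp Require Import ring lra.

Import Order.TTheory GRing.Theory Num.Theory.
Import numFieldNormedType.Exports.

Local Open Scope classical_set_scope.
Local Open Scope ring_scope.

(** Away from the boundary, [interior A] and [closure A] cut the same subset out of [C]. That subset
    is both open and closed in [C] and nonempty, hence all of [C]. *)
Lemma connected_disjoint_boundary (T : topologicalType) (C A : set T) :
  connected C -> C `&` boundary A = set0 -> C `&` A !=set0 -> C `<=` A.
Proof.
move=> cC CA0 [p [Cp Ap]].
have CAE : C `&` interior A = C `&` closure A.
  apply/seteqP; split=> x [Cx Ax]; split=> //.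
    by apply: subset_closure; apply: interior_subset.
  apply: contrapT => nAx; suff: (set0 : set T) x by [].
  by rewrite -CA0.
have <- : C `&` interior A = C; last by move=> x [_ /interior_subset].
apply: cC.
- by exists p; rewrite CAE; split=> //; apply: subset_closure.
- by exists (interior A) => //; exact: open_interior.
- by exists (closure A) => //; exact: closed_closure.
Qed.

(** [D] is the union of the segments issuing from one of its points [p]. Each is a continuous image
    of [[0, 1]], and all of them contain [p]. *)
Lemma convex_connected (R : realType) (V : normedModType R) (D : set V) :
  (forall p q s, D p -> D q -> 0 <= s <= 1 -> D (p + s *: (q - p))) ->
  connected D.
Proof.
move=> cvxD; have [->|/set0P[p Dp]] := eqVneq D set0; first exact: connected0.
pose segment q := (fun s : R => p + s *: (q - p)) @` `[0, 1].
have -> : D = \bigcup_(q in D) segment q.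
  apply/seteqP; split=> [q Dq|_ [q Dq [s s01 <-]]].
    exists q => //; exists 1; first by rewrite /= in_itv/= ler01 lexx.
    by rewrite scale1r addrC subrK.
  by apply: cvxD => //; move: s01; rewrite /= in_itv.
apply: bigcup_connected => [|q Dq].
  by exists p => q Dq; exists 0; rewrite ?scale0r ?addr0//= in_itv/= lexx ler01.
apply: connected_continuous_connected; first exact: segment_connected.
apply: continuous_subspaceT => s; apply: cvgD; first exact: cvg_cst.
by apply: cvgZr_tmp; exact: cvg_id.
Qed.

Section MatrixLimits.
Context {R : realType} {T : Type} {F : set_system T} {FF : Filter F}.

(** A neighbourhood of a matrix contains a product of neighbourhoods of its entries, and these are
    finitely many. *)
Lemma cvg_mx {m n} {f : T -> 'M[R]_(m, n)} {A : 'M[R]_(m, n)} :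
  (forall i j, f x i j @[x --> F] --> A i j) -> f x @[x --> F] --> A.
Proof.
move=> fA P [/= Q QA QP].
near=> x; apply: QP; near: x.
apply: filter_forall => i; apply: filter_forall => j.
exact: fA (QA i j).
Unshelve. all: by end_near. Qed.

Lemma cvg_entry {m n} {f : T -> 'M[R]_(m, n)} {A : 'M[R]_(m, n)} i j :
  f x @[x --> F] --> A -> f x i j @[x --> F] --> A i j.
Proof.
move=> fA; apply: (cvg_comp _ (fun M : 'M[R]_(m, n) => M i j) fA).
exact: coord_continuous.
Qed.

Lemma cvg_mulmx {m n p} {f : T -> 'M[R]_(m, n)} {g : T -> 'M[R]_(n, p)}
    {A : 'M[R]_(m, n)} {B : 'M[R]_(n, p)} :
  f x @[x --> F] --> A -> g x @[x --> F] --> B ->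
  f x *m g x @[x --> F] --> A *m B.
Proof.
move=> fA gB; apply: cvg_mx => i j; rewrite mxE.
under eq_fun do rewrite mxE.
apply: cvg_big => [|k _]; first exact: add_continuous.
by apply: cvgM; exact: cvg_entry.
Qed.

Lemma cvg_det {n} {f : T -> 'M[R]_n} {A : 'M[R]_n} :
  f x @[x --> F] --> A -> \det (f x) @[x --> F] --> \det A.
Proof.
move=> fA; apply: cvg_big => [|s _]; first exact: add_continuous.
apply: cvgM; first exact: cvg_cst.
by apply: cvg_big => [|i _]; [exact: mul_continuous|exact: cvg_entry].
Qed.

(** Since [\det A] is nonzero, [f x] is eventually invertible, where [invmx] is given by the
    adjugate formula. The entries of the adjugate are signed minors, so [cvg_det] applies to
    them. *)
Lemma cvg_invmx {n} {f : T -> 'M[R]_n} {A : 'M[R]_n} : A \in unitmx ->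
  f x @[x --> F] --> A -> invmx (f x) @[x --> F] --> invmx A.
Proof.
move=> uA fA; have dA : \det A != 0 by rewrite -unitfE -unitmxE.
have uf : \near F, f F \in unitmx.
  near=> x; rewrite unitmxE unitfE; near: x.
  exact: (cvgr_neq0 (\det A) (cvg_det fA) dA).
rewrite [X in _ --> X]/invmx uA.
apply: (cvg_trans (G := (\det (f x))^-1 *: \adj (f x) @[x --> F])).
  by apply: near_eq_cvg; near do rewrite /invmx ifT//.
apply: cvgZ; first by apply: cvgV => //; exact: cvg_det.
apply: cvg_mx => i j; rewrite mxE; under eq_fun do rewrite mxE.
apply: cvgM; first exact: cvg_cst.
apply: cvg_det; apply: cvg_mx => k l; rewrite !mxE.
by under eq_fun do rewrite !mxE; exact: cvg_entry.
Unshelve. all: by end_near. Qed.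

End MatrixLimits.

Lemma det_mx22 (K : comNzRingType) (A : 'M[K]_2) :
  \det A = A 0 0 * A 1 1 - A 0 1 * A 1 0.
Proof.
rewrite (expand_det_row _ ord0) !big_ord_recl big_ord0 /cofactor !det_mx11 !mxE.
have l0 : lift ord0 0 = 1 :> 'I_2 by apply: val_inj.
have l1 : lift 1 0 = 0 :> 'I_2 by apply: val_inj.
rewrite !l0 !l1 /=; ring.
Qed.

Section ClohessyWiltshire.
Context {R : realType}.

(** The difference [sin x - x * cos x] vanishes at 0 and has derivative [x * sin x], which is
    positive on [(0, pi)]. *)
Lemma ltr_mul_cos_sin (x : R) : 0 < x < pi -> x * cos x < sin x.
Proof.
move=> /andP[x0 xpi].
have [||c] := @MVT R (fun x => sin x - x * cos x) (fun x => x * sin x) 0 x x0.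
- move=> y _; apply: is_derive_eq; rewrite /GRing.scale/=; ring.
- by apply: continuous_subspaceT => y; apply: cvgB; [exact: continuous_sin|
    apply: cvgM; [exact: cvg_id|exact: continuous_cos]].
rewrite in_itv/= => /andP[c0 cx]; rewrite sin0 mul0r !subr0 => E.
rewrite -subr_gt0 E; apply: mulr_gt0 => //; apply: mulr_gt0 => //.
by apply: sin_gt0_pi; rewrite c0 (lt_trans cx).
Qed.

(** Up to a power of [kappa^-1], the determinant is the out-of-plane entry [sin th] times the
    determinant of the in-plane block. Both are positive for [0 < th < pi]. *)
Lemma Frv_unit (kappa t : R) : 0 < kappa -> 0 < t < pi / kappa ->
  Frv kappa t \in unitmx.
Proof.
move=> k0 /andP[t0 tpi]; rewrite unitmxE unitfE detZ.
apply: mulf_neq0; first by rewrite expf_neq0 ?invr_neq0 ?gt_eqF.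
set th := kappa * t.
have th0 : 0 < th by rewrite mulr_gt0.
have thpi : th < pi by rewrite /th mulrC -ltr_pdivlMr.
have s0 : 0 < sin th by rewrite sin_gt0_pi// th0.
pose x := th / 2.
have x0 : 0 < x < pi / 2 by rewrite /x; apply/andP; split; lra.
have sx := sin_gt0_pihalf x0.
have key : x * cos x < sin x by apply: ltr_mul_cos_sin; apply/andP; split; lra.
have -> : \det (mx3_of_rows
    [:: [:: sin th;                 2 * (1 - cos th);      0];
        [:: - (2 * (1 - cos th));   4 * sin th - 3 * th;   0];
        [:: 0;                      0;                     sin th]])
  = sin th * (sin th * (4 * sin th - 3 * th) + (2 * (1 - cos th)) ^+ 2).
  rewrite (expand_det_row _ ord_max) !big_ord_recr big_ord0/= /cofactor.
  by rewrite !det_mx22 !mxE/=; ring.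
apply: lt0r_neq0; apply: mulr_gt0 => //.
(* At the half angle x the bracket is 4 sin x (4 sin x - 3 x cos x). *)
have -> : th = x *+ 2 by rewrite /x; lra.
rewrite sin_mulr2n cos_mulr2n.
have -> : cos x * sin x *+ 2 * (4 * (cos x * sin x *+ 2) - 3 * (x *+ 2)) +
    (2 * (1 - (cos x ^+ 2 *+ 2 - 1))) ^+ 2 =
    4 * sin x * (4 * sin x - 3 * (x * cos x)).
  (* Writing s and c for [sin x] and [cos x], the Pythagorean identity then merges 16 s^2 c^2 + 16
     s^4 into 16 s^2. *)
  transitivity (4 * sin x * (4 * sin x * cos x ^+ 2 - 3 * (x * cos x)) +
    16 * (1 - cos x ^+ 2) ^+ 2); first by ring.
  by rewrite cos2sin2; ring.
(* The last factor equals [sin x + 3 * (sin x - x * cos x)], positive by [sx] and [key]. *)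
by rewrite !mulr_gt0//; lra.
Qed.

Lemma continuous_mx3_of_rows (T : topologicalType) (f : T -> seq (seq R)) :
  (forall i j, (i < 3)%N -> (j < 3)%N ->
    continuous (fun x => nth 0 (nth [::] (f x) i) j)) ->
  continuous (fun x => mx3_of_rows (f x)).
Proof.
move=> cf x; apply: cvg_mx => i j; rewrite mxE.
by under eq_fun do rewrite mxE; exact: cf.
Qed.

Local Lemma continuous_cos_mull (k : R) : continuous (fun t => cos (k * t)).
Proof.
by move=> t; apply: continuous_comp;
  [exact: mulrl_continuous|exact: continuous_cos].
Qed.

Local Lemma continuous_sin_mull (k : R) : continuous (fun t => sin (k * t)).
Proof.
by move=> t; apply: continuous_comp;
  [exact: mulrl_continuous|exact: continuous_sin].
Qed.

Ltac entry_cvg := repeat first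
  [ exact: cvg_cst | exact: cvg_id | exact: continuous_cos_mull
  | exact: continuous_sin_mull | apply: cvgD | apply: cvgN | apply: cvgM ].

Lemma continuous_Frr kappa : continuous (@Frr R kappa).
Proof.
apply: continuous_mx3_of_rows => -[|[|[|//]]] [|[|[|//]]] _ _ t /=; entry_cvg.
Qed.

Lemma continuous_Frv kappa : continuous (@Frv R kappa).
Proof.
move=> t; apply: cvgZl_tmp; move: t.
apply: continuous_mx3_of_rows => -[|[|[|//]]] [|[|[|//]]] _ _ t /=; entry_cvg.
Qed.

(** The delicate term is the inverse in [F2]; the bounds on [p.2] keep [Frv kappa p.2]
    invertible. *)
Lemma continuous_trajectory kappa (ri rj : 'cV[R]_3) (p : R^o * R^o) :
  0 < kappa -> 0 < p.2 < pi / kappa ->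
  {for p, continuous (fun q : R^o * R^o =>
    F1 kappa q.1 q.2 *m ri + F2 kappa q.1 q.2 *m rj)}.
Proof.
move=> k0 p2.
have cF2 : F2 kappa q.1 q.2 @[q --> p] --> F2 kappa p.1 p.2.
  apply: cvg_mulmx.
    by apply: (cvg_comp fst (Frv kappa)); [exact: cvg_fst|exact: continuous_Frv].
  apply: cvg_invmx; first exact: Frv_unit.
  by apply: (cvg_comp snd (Frv kappa)); [exact: cvg_snd|exact: continuous_Frv].
apply: cvgD; apply: cvg_mulmx; try exact: cvg_cst; last exact: cF2.
apply: cvgB.
  by apply: (cvg_comp fst (Frr kappa)); [exact: cvg_fst|exact: continuous_Frr].
apply: cvg_mulmx; first exact: cF2.
by apply: (cvg_comp snd (Frr kappa)); [exact: cvg_snd|exact: continuous_Frr].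
Qed.

Lemma reach_union_connected kappa (ri rj : 'cV[R]_3) :
  0 < kappa -> connected (reach_union kappa ri rj).
Proof.
move=> k0.
(* [R^o] is [R] as a normed module over itself, so that the product is a normed space, as
   [convex_connected] requires. The bound [t < pi / kappa] is implied by [t < tau < pi / kappa]. *)
pose D : set (R^o * R^o) :=
  [set q | [/\ 0 < q.1, q.1 < q.2 & q.2 < pi / kappa]].
have -> : reach_union kappa ri rj =
    (fun q => F1 kappa q.1 q.2 *m ri + F2 kappa q.1 q.2 *m rj) @` D.
  apply/seteqP; split=> [x [t /= + [tau /= + <-]]|
      _ [[t tau] /= [t0 ttau taup] <-]].
    rewrite !in_itv/= => /andP[t0 tp] /andP[ttau taup].
    by exists (t, tau).
  exists t; first by rewrite /= in_itv/= t0 (lt_trans ttau).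
  by exists tau => //=; rewrite in_itv/= ttau.
apply: connected_continuous_connected.
  apply: convex_connected => -[t tau] [t' tau'] s
    [/= t0 ttau taup] [/= t0' ttau' taup'].
  move=> /andP[s0 s1].
  (* The triangle is where the affine functions [t], [tau - t] and [pi / kappa - tau] are all
     positive, and positivity at both ends of a segment passes to the whole segment. *)
  have cvx_gt0 a b : 0 < a -> 0 < b -> 0 < a + s * (b - a).
    by move=> a0 b0; have [ab|ba] := leP a b; nra.
  have gt_t := cvx_gt0 _ _ t0 t0'.
  have gt_tau := cvx_gt0 (tau - t) (tau' - t').
  have gt_p := cvx_gt0 (pi / kappa - tau) (pi / kappa - tau').
  by split; rewrite /= /GRing.scale/=; lra.
apply: continuous_in_subspaceT => q /set_mem[q1 q12 q2].
by apply: continuous_trajectory => //; rewrite q2 (lt_trans q1).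
Qed.

End ClohessyWiltshire.

Theorem proposition2 (R : realType) (kappa : R) (kappa_gt0 : 0 < kappa)
    (ri rj rs : 'cV[R]_3)
    (rs_reachable : exists t : R,
       0 < t < pi / kappa /\ reachable_at kappa ri rj t rs)
    (S : set 'cV[R]_3)
    (S_surface : connected_closed_surface (boundary S))
    (rs_notin_S : ~ S rs) :
  ((forall p, boundary S p ->
      forall t : R, 0 < t < pi / kappa -> unreachable_at kappa ri rj t p) ->
   (forall p, S p ->
      forall t : R, 0 < t < pi / kappa -> unreachable_at kappa ri rj t p))
  /\
  (boundary S `&` reach_union kappa ri rj = set0 ->
   S `&` reach_union kappa ri rj = set0).
Proof.
have main : boundary S `&` reach_union kappa ri rj = set0 ->
    S `&` reach_union kappa ri rj = set0.
  move=> bdS; apply/eqP/negPn/negP => /set0P[p [Sp Qp]].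
  (* A point [p] of [S] in the reachable union would pull the whole union, and [rs] with it, into
     [S]. *)
  apply: rs_notin_S.
  apply: (connected_disjoint_boundary _ _ _
    (@reach_union_connected _ _ ri rj kappa_gt0)).
  - by rewrite setIC.
  - by exists p.
  - by have [t [t_itv rst]] := rs_reachable; exists t => //=; rewrite in_itv.
split=> // bdS p Sp t t_itv pt.
suff : (set0 : set 'cV[R]_3) p by [].
(* The pointwise form reduces to the set form: a reachable [p] in [S] would lie in an empty
   intersection. *)
rewrite -main; last first.
  apply/seteqP; split=> // q [bq [u /= + qu]]; rewrite in_itv/= => u_itv.
  exact: bdS bq u u_itv qu.
by split => //; exists t => //=; rewrite in_itv.
Qed.
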